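(* Let $m\geq 1$ be a fixed integer. With $A_n$, $l_n$, $A$, $F(A,\cdot)$ and $F_n = F(A,l_n)$ as defined in the context (all depending on $m$), the logarithm of the growth rate of the size of the set of inflated generalised random Fibonacci words equals the topological entropy $\lim_{N\to\infty}\frac{1}{N}\log|F(A,N)|$ of the generalised random Fibonacci chain; that is, $$\lim_{n\to\infty}\frac{\log|A_n|}{l_n} = \lim_{n\to\infty}\frac{\log|F_n|}{l_n}.$$
   Context: Words are finite sequences of symbols from $\{0,1\}$. For a word $w=w_1w_2\cdots w_r$, $w[a,b]=w_aw_{a+1}\cdots w_b$ denotes a sub-word (the empty word if $b=a-1$), and for a set of words $W$, $W[a,b]=\{w[a,b]:w\in W\}$. $|\cdot|$ denotes the length of a word or the cardinality of a set. For sets of words $U,V$, the product is $UV=\{uv:u\in U,v\in V\}$ (all concatenations); $\prod_{j=0}^{m}$ denotes such a product of sets taken in order of increasing $j$ from left to right. Fix an integer $m\ge 1$. The generalised random Fibonacci substitution maps $0\mapsto 1$ and $1\mapsto 1^i01^{m-i}$ with probability $p_i$ ($0\le i\le m$), applied independently to each occurrence of $1$. The sets of inflated words are defined by $A_1=\{0\}$, $A_2=\{1\}$ and, for $n\ge 3$, $$A_n=\bigcup_{i=0}^{m}\prod_{j=0}^{m}A_{n-1-\delta_{ij}},$$ where $\delta_{ij}=1$ if $i=j$ and $0$ otherwise. All words in $A_n$ have the same length, denoted $l_n$; so $l_1=l_2=1$ and $l_n=m\,l_{n-1}+l_{n-2}$ for $n\ge3$. $A:=\lim_{n\to\infty}A_n$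 is the set of right-infinite words $x$ over $\{0,1\}$ such that for every $n\ge 3$ the prefix of $x$ of length $l_n-1$ belongs to $A_n[1,l_n-1]$ (these prefix sets are consistent: $A_n[1,l_n-1]=A_{n+k}[1,l_n-1]$ for $n\geq 3$, $k\geq 0$). A finite word $x$ is a factor of a (finite or right-infinite) word $w$ if $w=uxv$ for some (possibly empty) words $u,v$, with $u$ finite and $v$ right-infinite if $w$ is. For a set $S$ of words, $F(S,N)$ is the set of all factors of length $N$ of words in $S$. Put $F_n:=F(A,l_n)$. The topological entropy of the generalised random Fibonacci chain is $\lim_{N\to\infty}\frac1N\log|F(A,N)|$, which exists by subadditivity. *)

(* Defs.v *)
From HB Require Import structures.
From mathcomp Require Import all_boot all_order all_algebra finmap.
From mathcomp Require Import all_classical all_reals all_analysis.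

Set Implicit Arguments.
Unset Strict Implicit.
Unset Printing Implicit Defensive.

Import Order.TTheory GRing.Theory Num.Theory.
Import numFieldNormedType.Exports.

(* Letters 0 and 1 are [false] and [true]; the letters of a right-infinite
   word w_1 w_2 ... are stored from index 0, so w_1 is [w 0]. *)
Definition word := seq bool.
Definition infinite_word := nat -> bool.

Definition subword (a b : nat) (w : word) : word := drop a.-1 (take b w).

Definition subwords (W : {fset word}) (a b : nat) : {fset word} :=
  [fset subword a b w | w in W]%fset.

Definition prodw (U V : {fset word}) : {fset word} :=
  [fset u ++ v | u in U, v in V]%fset.

(* The value at n = 0, where nothing is prescribed, is a junk value. *)
Fixpoint inflated (m n : nat) {struct n} : {fset word} :=
  match n with
  | 0 => fset0
  | 1 => [fset [:: false]]
  | S (S k as k1) =>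
      if k is 0 then [fset [:: true]] else
      \big[fsetU/fset0]_(i < m.+1)
        \big[prodw/[fset [::]]]_(j < m.+1)
          (if i == j then inflated m k else inflated m k1)
  end%fset.

(* Again the value at n = 0 is a junk value. *)
Fixpoint len (m n : nat) {struct n} : nat :=
  match n with
  | 0 => 0
  | 1 => 1
  | S (S k as k1) => if k is 0 then 1 else m * len m k1 + len m k
  end.

Lemma inflatedE (m n : nat) : 3 <= n ->
  inflated m n =
  \big[fsetU/fset0]_(i < m.+1)
    \big[prodw/[fset [::]]%fset]_(j < m.+1) inflated m (n - 1 - (i == j)).
Proof.
case: n => [|[|[|n]]] // _; rewrite [LHS]/=.
apply: eq_bigr => i _; apply: eq_bigr => j _.
by case: eqP => _; rewrite subSS subn0 ?subn0 ?subn1.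
Qed.

Lemma lenE (m n : nat) : 3 <= n -> len m n = m * len m n.-1 + len m n.-2.
Proof. by case: n => [|[|[|n]]]. Qed.

Lemma mem_prodw_seq (I : Type) (r : seq I) (W : I -> {fset word})
    (k : I -> nat) :
  (forall i w, w \in W i -> size w = k i) ->
  forall w, w \in \big[prodw/[fset [::]]%fset]_(i <- r) W i ->
  size w = \sum_(i <- r) k i.
Proof.
move=> Wk; elim: r => [|i r IHr] w.
  by rewrite !big_nil in_fset1 => /eqP ->.
rewrite !big_cons => /imfset2P[u /= uW [v /= vW ->]].
by rewrite size_cat (Wk i) // IHr.
Qed.

Lemma size_inflated (m n : nat) (w : word) :
  w \in inflated m n -> size w = len m n.
Proof.
suff: (forall w, w \in inflated m n -> size w = len m n) /\
      (forall w, w \in inflated m n.+1 -> size w = len m n.+1).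
  by case=> + _; exact.
elim: n {w} => [|n [IHn IHn1]].
  by split=> w /=; rewrite ?inE // => /eqP ->.
split=> // w; case: n => [|n] in IHn IHn1 *.
  by rewrite /= inE => /eqP ->.
rewrite inflatedE // lenE //.
case/bigfcupP => i _ /(mem_prodw_seq (k := fun j => len m (n.+3 - 1 - (i == j)))).
move=> -> /=.
  rewrite (bigD1 i) //= eqxx addnC; congr (_ + _).
  rewrite (eq_bigr (fun=> len m n.+2)); last first.
    by move=> j; rewrite eq_sym => /negbTE ->; rewrite subn1 subn0.
  by rewrite sum_nat_const cardC1 card_ord.
move=> j v; case: (i == j); rewrite ?subSS ?subn0.
  exact: IHn.
exact: IHn1.
Qed.

Local Open Scope classical_set_scope.

(* The set of right-infinite words A; [mkseq x k] is the prefix of x of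
   length k. *)
Definition limit_words (m : nat) : set infinite_word :=
  [set x | forall n, (3 <= n)%N ->
     mkseq x (len m n).-1 \in subwords (inflated m n) 1 (len m n).-1].

Definition cat_infinite (u : word) (v : infinite_word) : infinite_word :=
  fun k => nth (v (k - size u)%N) u k.

Definition factor (x : word) (w : infinite_word) : Prop :=
  exists (u : word) (v : infinite_word), w = cat_infinite (u ++ x) v.

Definition factors (S : set infinite_word) (N : nat) : {set N.-tuple bool} :=
  finset (fun x : N.-tuple bool => `[< exists2 w, S w & factor x w >]).

Local Open Scope ring_scope.

(* (log |F(A,N)|) / N, at N = 0 equal to 0 by the convention on division. *)
Definition entropy_seq (R : realType) (m N : nat) : R :=
  ln (#|factors (limit_words m) N|%:R) / N%:R.

Definition topological_entropy (R : realType) (m : nat) : R :=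
  limn (entropy_seq R m).

(* Main.v *)
(* Write L_n = log |A_n|, h_n = L_n / l_n and let h be the entropy, which exists
   because log |F(A,N)| is subadditive in N.
   Each w in A_n is a factor of a word of A: start from a sequence with
   u_(k+2) = u_(k+1)^m u_k and replace the final u_n of u_(n+2) by w. Hence
   |A_n| <= |F_n|.
   Conversely, every word of A is a limit of concatenations of blocks from A_n and
   A_(n+1), and a word of length N involves at most about N / l_n choices between
   the two kinds of blocks; hence h <= max(h_n, h_(n+1)) + log 2 / l_n.
   Finally L_(n+2) - m L_(n+1) - L_n lies between 0 and log (m + 1), so that
   h_(n+1) - h_n = O(1 / l_n), and h_n is squeezed between h - O(1 / l_n) and
   log |F_n| / l_n. *)

Require Import Defs.
From HB Require Import structures.
From mathcomp Require Import all_boot all_order all_algebra finmap.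
From mathcomp Require Import all_classical all_reals all_analysis.
From mathcomp Require Import zify ring.

Set Implicit Arguments.
Unset Strict Implicit.
Unset Printing Implicit Defensive.

Import Order.TTheory GRing.Theory Num.Theory.
Import numFieldNormedType.Exports.
Local Open Scope classical_set_scope.
Local Open Scope ring_scope.

(** * Factors as windows, and submultiplicativity of their number *)

Lemma mem_factors (S : set infinite_word) (N : nat) (x : N.-tuple bool) :
  x \in factors S N <->
  exists2 w, S w & exists k, val x = mkseq (fun i => w (k + i)%N) N.
Proof.
rewrite inE asboolE; split=> -[w Sw].
  case=> u [v wE]; exists w => //; exists (size u).
  apply: (@eq_from_nth _ false); rewrite size_tuple ?size_mkseq // => i ltiN.
  rewrite nth_mkseq // wE /cat_infinite.
  rewrite [nth (v _) _ _](set_nth_default false) ?size_cat ?size_tuple ?ltn_add2l //.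
  by rewrite nth_cat -[X in (_ < X)%N]addn0 ltn_add2l addKn.
case=> k xE; exists w => //; exists (mkseq w k), (fun i => w (k + N + i)%N).
apply/funext => i; rewrite /cat_infinite size_cat size_mkseq size_tuple.
rewrite nth_cat size_mkseq; case: ltnP => [ltik|leki]; first by rewrite nth_mkseq.
rewrite xE; have [ltiN|leNi] := ltnP (i - k) N.
  by rewrite nth_mkseq // subnKC.
by rewrite nth_default ?size_mkseq //; congr w; lia.
Qed.

(** Cutting a factor after M letters is injective, and both pieces are factors of the same infinite
    word. *)
Lemma card_factorsD (S : set infinite_word) (M N : nat) :
  (#|factors S (M + N)| <= #|factors S M| * #|factors S N|)%N.
Proof.
pose f (x : (M + N).-tuple bool) : M.-tuple bool * N.-tuple bool :=
  ([tuple of mkseq (nth false x) M],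
   [tuple of mkseq (fun i => nth false x (M + i)) N]).
have f_inj : injective f.
  move=> x y [exy1 exy2]; apply/val_inj/(@eq_from_nth _ false) => /=.
    by rewrite !size_tuple.
  move=> i; rewrite size_tuple => lti; have [ltiM|leMi] := ltnP i M.
    by move/(congr1 (nth false ^~ i)): exy1; rewrite !nth_mkseq.
  have /(congr1 (nth false ^~ (i - M)%N)) := exy2.
  by rewrite !nth_mkseq ?subnKC //; lia.
rewrite -(card_imset _ f_inj) -cardsX; apply/subset_leq_card/fintype.subsetP.
move=> _ /imsetP[x /mem_factors[w Sw [k xE]] ->]; rewrite finset.in_setX.
apply/andP; split; apply/mem_factors; exists w => //.
  exists k; apply/eq_in_map => i; rewrite mem_iota => /andP[_ lti].
  by rewrite xE nth_mkseq //; lia.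
exists (k + M)%N; apply/eq_in_map => i; rewrite mem_iota => /andP[_ lti].
by rewrite xE nth_mkseq ?addnA //; lia.
Qed.

(** * Cardinalities and lengths of the inflated sets *)

(** The common length k of the left factors fixes the cut point, so concatenation is injective on
    pairs. *)
Lemma card_prodw (k : nat) (U V : {fset word}) :
  (forall u, u \in U -> size u = k) ->
  #|` prodw U V| = (#|` U| * #|` V|)%N.
Proof.
move=> Uk; rewrite -(size_allpairs cat (enum_fset U) (enum_fset V)).
apply/perm_size/uniq_perm; first exact: fset_uniq.
  apply: allpairs_uniq; rewrite ?fset_uniq // => -[u v] [u' v'].
  case/allpairsP => -[u1 v1] /= [u1U _ [-> _]].
  case/allpairsP => -[u2 v2] /= [u2U _ [-> _]] /eqP.
  by rewrite eqseq_cat ?(Uk u1) ?(Uk u2) // => /andP[/eqP -> /eqP ->].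
move=> w; apply/imfset2P/allpairsP => /= [[u uU [v vV ->]]|].
  by exists (u, v).
by case=> -[u v] /= [uU vV ->]; exists u => //; exists v.
Qed.

Lemma card_big_prodw (I : Type) (r : seq I) (W : I -> {fset word})
    (k : I -> nat) :
  (forall i w, w \in W i -> size w = k i) ->
  #|` \big[prodw/[fset [::]]%fset]_(i <- r) W i| = \prod_(i <- r) #|` W i|.
Proof.
move=> Wk; elim: r => [|i r IHr]; first by rewrite !big_nil cardfs1.
by rewrite !big_cons (@card_prodw (k i)) ?IHr //; apply: Wk.
Qed.

Lemma lenS (m n : nat) : (0 < n)%N ->
  len m n.+2 = (m * len m n.+1 + len m n)%N.
Proof. by case: n. Qed.

Lemma inflatedS (m n : nat) : (0 < n)%N ->
  inflated m n.+2 =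
  (\big[fsetU/fset0]_(i < m.+1) \big[prodw/[fset [::]]]_(j < m.+1)
     inflated m (if i == j then n else n.+1))%fset.
Proof.
case: n => // n _; rewrite [LHS]/=.
by apply: eq_bigr => i _; apply: eq_bigr => j _; case: (i == j).
Qed.

(** Wherever the exceptional block stands, a branch has m factors of index n + 1 and one of index n,
    so all branches have the same size. *)
Lemma card_inflated_branch (m n : nat) (i : 'I_m.+1) :
  #|` \big[prodw/[fset [::]]%fset]_(j < m.+1)
       inflated m (if i == j then n else n.+1)| =
  (#|` inflated m n.+1| ^ m * #|` inflated m n|)%N.
Proof.
rewrite (@card_big_prodw _ _ _ (fun j => len m (if i == j then n else n.+1)));
  last by move=> j w; apply: size_inflated.
rewrite (bigD1 i) //= eqxx mulnC; congr (_ * _)%N.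
rewrite (eq_bigr (fun=> #|` inflated m n.+1|)); last first.
  by move=> j; rewrite eq_sym => /negbTE ->.
by rewrite prod_nat_const cardC1 card_ord.
Qed.

Lemma card_inflated_ge (m n : nat) : (0 < n)%N ->
  (#|` inflated m n.+1| ^ m * #|` inflated m n| <= #|` inflated m n.+2|)%N.
Proof.
move=> n0; rewrite -(card_inflated_branch n ord0) inflatedS //.
apply/fsubset_leq_card/(@bigfcup_sup _ _ _ ord0) => //.
exact: mem_index_enum.
Qed.

(** The branches may overlap, so their union is only bounded by the sum of the m + 1 equal sizes. *)
Lemma card_inflated_le (m n : nat) : (0 < n)%N ->
  (#|` inflated m n.+2|
    <= m.+1 * (#|` inflated m n.+1| ^ m * #|` inflated m n|))%N.
Proof.
move=> n0; rewrite inflatedS //.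
rewrite -[X in (_ <= X * _)%N]card_ord -sum_nat_const.
under [X in (_ <= X)%N]eq_bigr => i _ do rewrite -(card_inflated_branch n i).
elim/big_rec2: _ => [|i s U _ IH]; first by rewrite cardfs0.
by rewrite (leq_trans (leq_card_fsetU _ _).1) ?leq_add2l.
Qed.

Lemma card_inflated_gt0 (m n : nat) : (0 < n)%N -> (0 < #|` inflated m n|)%N.
Proof.
case: n => // n _.
suff: (0 < #|` inflated m n.+1|)%N /\ (0 < #|` inflated m n.+2|)%N by case.
elim: n => [|n [IHn IHn1]]; first by rewrite /= !cardfs1.
split=> //; apply: leq_trans (card_inflated_ge _ _) => //.
by rewrite muln_gt0 expn_gt0 IHn1.
Qed.

Lemma len_gt0 (m n : nat) : (0 < m)%N -> (0 < n)%N -> (0 < len m n)%N.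
Proof.
move=> m0; case: n => // n _.
suff: (0 < len m n.+1)%N /\ (0 < len m n.+2)%N by case.
by elim: n => // n [IHn IHn1]; split=> //; rewrite lenS // addn_gt0 IHn orbT.
Qed.

(** A crude linear bound, enough for [len m n] to tend to infinity and to find inflated words of any
    required length. *)
Lemma leq_len (m n : nat) : (0 < m)%N -> (n <= len m n.+1)%N.
Proof.
move=> m0; suff: (n <= len m n.+1)%N /\ (n < len m n.+2)%N by case.
elim: n => // n [IHn IHn1]; split=> //; rewrite lenS //.
by have := len_gt0 m0 (ltn0Sn n); nia.
Qed.

Lemma leq_lenS (m n : nat) : (0 < m)%N -> (len m n <= len m n.+1)%N.
Proof.
by case: n => [|[|n]] // m0; rewrite (@lenS m n.+1) //; nia.
Qed.

(** * Counting factors through decompositions into blocks *)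

(* The two factors 1/2 pay for the choice, at each block, between U and V. *)
Lemma card_prefixes_le (R : realType) (U V : {fset word}) (p q N : nat) (c : R) :
  (0 < p)%N -> (p <= q)%N -> 0 <= c ->
  (forall u, u \in U -> size u = p) -> (forall v, v \in V -> size v = q) ->
  #|` U|%:R <= expR (c * p%:R) / 2 -> #|` V|%:R <= expR (c * q%:R) / 2 ->
  exists2 S : {fset word}, #|` S|%:R <= 2 ^+ q * expR (c * N%:R) :> R
    & forall bs : seq word, {subset bs <= (U `|` V)%fset} ->
      (N <= size (flatten bs))%N -> take N (flatten bs) \in S.
Proof.
move=> p0 pq c0 Up Vq Ub Vb; elim/ltn_ind: N => N IHN.
have [ltNq|leqN] := ltnP N q.
  exists [fset val x | x in {: N.-tuple bool}]%fset.
    apply: (@le_trans _ _ (2 ^+ N)).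
      rewrite -natrX ler_nat (leq_trans (leq_imfset_card _ _ _)) //=.
      by rewrite -cardE card_tuple card_bool.
    rewrite -[X in X <= _]mulr1 ler_pM // ?exprn_ge0 //.
      by rewrite ler_weXn2l ?ler1n // ltnW.
    by rewrite -expR0 ler_expR mulr_ge0.
  move=> bs _ leN; apply/imfsetP.
  have szN : size (take N (flatten bs)) == N by rewrite size_takel.
  by exists (Tuple szN) => //=; rewrite inE.
have [SU SUcard SUP] := IHN (N - p)%N ltac:(lia).
have [SV SVcard SVP] := IHN (N - q)%N ltac:(lia).
(* Split according to whether the first block lies in U or in V; each case contributes at most half
   of the bound. *)
exists (prodw U SU `|` prodw V SV)%fset.
  have half (W S : {fset word}) (r : nat) : (r <= N)%N ->
      (forall w, w \in W -> size w = r) ->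
      #|` W|%:R <= expR (c * r%:R) / 2 ->
      #|` S|%:R <= 2 ^+ q * expR (c * (N - r)%:R) :> R ->
      #|` prodw W S|%:R <= 2 ^+ q * expR (c * N%:R) / 2 :> R.
    move=> rN Wr Wb Sb; rewrite (card_prodw S Wr) natrM.
    apply: (le_trans (ler_pM _ _ Wb Sb)) => //.
    rewrite -[in leRHS](subnK rN) natrD mulrDr expRD.
    by rewrite le_eqVlt; apply/orP; left; apply/eqP; field.
  apply: (@le_trans _ _ (#|` prodw U SU|%:R + #|` prodw V SV|%:R)).
    by rewrite -natrD ler_nat (leq_card_fsetU _ _).1.
  rewrite [leRHS]splitr lerD //.
    by apply: half SUcard => //; apply: leq_trans leqN.
  exact: half SVcard.
have step (W S : {fset word}) (r : nat) (b : word) (bs : seq word) :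
    (r <= N)%N -> (forall w, w \in W -> size w = r) -> b \in W ->
    ((N - r <= size (flatten bs))%N -> take (N - r) (flatten bs) \in S) ->
    (N <= size (b ++ flatten bs))%N ->
    take N (b ++ flatten bs) \in prodw W S.
  move=> rN Wr bW SP; rewrite size_cat (Wr b bW) => leN.
  rewrite take_cat (Wr b bW) ltnNge rN /=; apply: in_imfset2 => //=.
  by apply: SP; rewrite leq_subLR.
case=> [|b bs] bsUV /=; first by rewrite leqn0 => /eqP N0; lia.
have bsUV' : {subset bs <= (U `|` V)%fset}.
  by move=> x xbs; apply: bsUV; rewrite inE xbs orbT.
have pN : (p <= N)%N by apply: leq_trans leqN.
have := bsUV b (mem_head _ _); rewrite !inE => /orP[bU|bV] leN; apply/orP.
  by left; apply: (step U SU p) => //; apply: SUP.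
by right; apply: (step V SV q) => //; apply: SVP.
Qed.

(** Blocks ending at or before position k are discarded; what remains to drop lies inside one block,
    hence the offset j < q. *)
Lemma drop_flatten_blocks (q k : nat) (bs : seq word) :
  (0 < q)%N -> (forall b, b \in bs -> (size b <= q)%N) ->
  exists j (bs' : seq word), [/\ (j < q)%N, (j <= size (flatten bs'))%N,
    {subset bs' <= bs} & drop k (flatten bs) = drop j (flatten bs')].
Proof.
move=> q0; elim: bs k => [|b bs IH] k bsq; first by exists 0%N, [::]; rewrite drop0.
have [ltk|lek] := ltnP k (size b).
  exists k, (b :: bs); split=> //; last by rewrite /= size_cat; lia.
  exact: leq_trans ltk (bsq _ (mem_head _ _)).
have [|j [bs' [jq jbs' bs'bs dropE]]] := IH (k - size b)%N.
  by move=> b' b'bs; apply: bsq; rewrite inE b'bs orbT.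
exists j, bs'; split=> //; last by rewrite /= drop_cat ltnNge lek.
by move=> b' /bs'bs b'bs; rewrite inE b'bs orbT.
Qed.

(** The recursion is unfolded down to level n. It has two terms, so the induction carries two
    consecutive indices. *)
Lemma inflated_blocks (m n k : nat) (w : word) : (0 < n)%N ->
  w \in inflated m (n + k) ->
  exists2 bs : seq word, {subset bs <= (inflated m n `|` inflated m n.+1)%fset} &
    w = flatten bs.
Proof.
move=> n0; pose blocks (W : {fset word}) := forall w, w \in W ->
  exists2 bs : seq word, {subset bs <= (inflated m n `|` inflated m n.+1)%fset} &
    w = flatten bs.
suff: blocks (inflated m (n + k)) /\ blocks (inflated m (n + k).+1).
  by case=> + _; exact.
elim: k => [|k [IH IH1]].
  rewrite addn0; split=> u uA; exists [:: u]; rewrite /= ?cats0 // => v;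
    by rewrite !inE => /eqP ->; rewrite uA ?orbT.
rewrite addnS; split=> // u; rewrite inflatedS ?ltn_addr //.
case/bigfcupP => i _; apply: (big_ind blocks).
- by move=> v; rewrite inE => /eqP ->; exists [::].
- move=> V W bV bW _ /imfset2P[v /= /bV[bs bsA ->] [v' /= /bW[bs' bs'A ->] ->]].
  exists (bs ++ bs'); last by rewrite flatten_cat.
  by move=> b; rewrite mem_cat => /orP[/bsA|/bs'A].
- by move=> j _; case: (i == j).
Qed.

Lemma card_factor_words (S : set infinite_word) (N : nat) :
  #|` [fset val x | x in factors S N]%fset| = #|factors S N|.
Proof. by rewrite card_imfset -?cardE //; apply: val_inj. Qed.

Lemma card_factors_le (R : realType) (m n : nat) (c : R) :
  (0 < m)%N -> (0 < n)%N -> 0 <= c ->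
  #|` inflated m n|%:R <= expR (c * (len m n)%:R) / 2 ->
  #|` inflated m n.+1|%:R <= expR (c * (len m n.+1)%:R) / 2 ->
  exists K : R, forall N,
    #|factors (limit_words m) N|%:R <= K * expR (c * N%:R).
Proof.
move=> m0 n0 c0 Un Un1.
have := leq_lenS n m0; set q := len m n.+1 => pq.
have q0 : (0 < q)%N by apply: len_gt0.
have p0 := len_gt0 m0 n0.
(* There are q offsets j inside the first block; 2^q comes from [card_prefixes_le], and exp(c q)
   absorbs the j < q extra letters of the prefix of length N + j. *)
exists (q%:R * (2 ^+ q * expR (c * q%:R))) => N.
pose P j := card_prefixes_le (N + j) p0 pq c0 (@size_inflated m n)
  (@size_inflated m n.+1) Un Un1.
pose S j := s2val (cid2 (P j)).
have Scard j : #|` S j|%:R <= 2 ^+ q * expR (c * (N + j)%:R) :> R.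
  by rewrite /S; case: (cid2 (P j)).
have SP j : forall bs : seq word,
    {subset bs <= (inflated m n `|` inflated m n.+1)%fset} ->
    (N + j <= size (flatten bs))%N -> take (N + j) (flatten bs) \in S j.
  by rewrite /S; case: (cid2 (P j)).
pose T := (\big[fsetU/fset0]_(j < q) [fset drop j w | w in S j])%fset.
have sub : ([fset val x | x in factors (limit_words m) N] `<=` T)%fset.
  apply/fsubsetP => _ /imfsetP[x /= /mem_factors[w wL [k xE]] ->].
  (* The defining condition on w controls one letter less than the full length, so the strict
     inequality is what places the window inside the controlled prefix. *)
  have [d d3 ltkN] : exists2 d, (3 <= n + d)%N & (k + N < len m (n + d))%N.
    exists (k + N).+3; first by lia.
    by have := leq_len (n + (k + N).+2) m0; rewrite -(addnS n); lia.
  have [v vA wE] : exists2 v, v \in inflated m (n + d) &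
      mkseq w (len m (n + d)).-1 = take (len m (n + d)).-1 v.
    have /imfsetP[v /= vA ->] := wL _ d3.
    by exists v; rewrite // /subword drop0.
  have {}xE : val x = take N (drop k v).
    have -> : take N (drop k v) =
        take N (drop k (mkseq w (len m (n + d)).-1)).
      by rewrite wE !take_drop take_takel //; lia.
    apply: (@eq_from_nth _ false) => [|i].
      by rewrite size_tuple size_takel // size_drop size_mkseq; lia.
    rewrite size_tuple => ltiN; rewrite xE nth_take // nth_drop.
    by rewrite !nth_mkseq //; lia.
  have [bs bsA vE] := inflated_blocks n0 vA.
  have [|j [bs' [jq jbs' bs'bs dropE]]] := @drop_flatten_blocks q k bs q0.
    by move=> b /bsA; rewrite inE => /orP[] /size_inflated ->.
  apply/bigfcupP; exists (Ordinal jq); first by rewrite mem_index_enum.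
  apply/imfsetP; exists (take (N + j) (flatten bs')) => /=.
    apply: SP; first by move=> b /bs'bs/bsA.
    have := congr1 size dropE; rewrite -vE !size_drop (size_inflated vA); lia.
  by rewrite xE vE dropE take_drop.
rewrite -card_factor_words.
apply: (@le_trans _ _ (\sum_(j < q) #|` S j|)%:R).
  rewrite ler_nat (leq_trans (fsubset_leq_card sub)) // /T.
  elim/big_rec2: _ => [|j s U _ IH]; first by rewrite cardfs0.
  rewrite (leq_trans (leq_card_fsetU _ _).1) // leq_add //.
  exact: leq_imfset_card.
rewrite natr_sum.
apply: (@le_trans _ _ (\sum_(j < q) 2 ^+ q * expR (c * q%:R) * expR (c * N%:R))).
  apply: ler_sum => j _; apply: (le_trans (Scard j)).
  rewrite -mulrA ler_wpM2l ?exprn_ge0 // -expRD ler_expR -mulrDr ler_wpM2l //.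
  by rewrite -natrD ler_nat addnC leq_add2r ltnW.
by rewrite sumr_const card_ord -[X in X <= _]mulr_natl !mulrA.
Qed.

(** * Every inflated word is a factor of a limit word *)

Lemma mem_big_prodw (I : Type) (r : seq I) (W : I -> {fset word})
    (f : I -> word) :
  (forall i, f i \in W i) ->
  flatten [seq f i | i <- r] \in \big[prodw/[fset [::]]%fset]_(i <- r) W i.
Proof.
move=> fW; elim: r => [|i r IHr] /=; first by rewrite big_nil inE.
by rewrite big_cons; apply: in_imfset2 => //=; apply: fW.
Qed.

(** This is the branch [ord_max], which puts the block of index n last, with the same u in the m
    other places. *)
Lemma mem_inflatedS (m n : nat) (u v : word) : (0 < n)%N ->
  u \in inflated m n.+1 -> v \in inflated m n ->
  flatten (nseq m u) ++ v \in inflated m n.+2.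
Proof.
move=> n0 uA vA; rewrite inflatedS //; apply/bigfcupP; exists ord_max.
  by rewrite mem_index_enum.
have := @mem_big_prodw _ (index_enum 'I_m.+1)
  (fun j => inflated m (if ord_max == j then n else n.+1))
  (fun j => if ord_max == j then v else u).
have -> : [seq (if ord_max == j then v else u) | j <- index_enum 'I_m.+1] =
    rcons (nseq m u) v.
  rewrite -[index_enum _]enumT enum_ordSr map_rcons eqxx; congr rcons.
  apply: (@eq_from_nth _ [::]) => [|j].
    by rewrite 2!size_map size_enum_ord size_nseq.
  rewrite 2!size_map size_enum_ord => ltjm; rewrite nth_nseq ltjm.
  rewrite -map_comp (nth_map (Ordinal ltjm)) ?size_enum_ord //=.
  by rewrite -val_eqE /= gtn_eqF.
rewrite flatten_rcons; apply => j; by case: (ord_max == j).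
Qed.

(* The words u_k, with w in place of the last block of u_(n+2); the value at
   k = 0 is junk. *)
Fixpoint spliced_word (m n : nat) (w : word) (k : nat) {struct k} : word :=
  match k with
  | 0 => [::]
  | 1 => [:: false]
  | S (S j as k1) =>
      if j is 0 then [:: true] else
      flatten (nseq m (spliced_word m n w k1)) ++
        (if j == n then w else spliced_word m n w j)
  end.

Lemma spliced_wordS (m n k : nat) (w : word) : (0 < k)%N ->
  spliced_word m n w k.+2 =
  flatten (nseq m (spliced_word m n w k.+1)) ++
    (if k == n then w else spliced_word m n w k).
Proof. by case: k. Qed.

Lemma mem_spliced_word (m n k : nat) (w : word) : (0 < k)%N ->
  w \in inflated m n -> spliced_word m n w k \in inflated m k.
Proof.
case: k => // k _ wA.
suff: spliced_word m n w k.+1 \in inflated m k.+1 /\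
    spliced_word m n w k.+2 \in inflated m k.+2 by case.
elim: k => [|k [IH IH1]]; first by rewrite /= !inE.
split=> //; rewrite spliced_wordS //; apply: mem_inflatedS => //.
by case: eqP => // ->.
Qed.

(** As m > 0, each word begins with its predecessor, and the splice only affects a last block. The
    start k = 1 is excluded because 0 is not a prefix of 1. *)
Lemma prefix_spliced_word (m n k i : nat) (w : word) : (0 < m)%N ->
  (1 < k)%N -> prefix (spliced_word m n w k) (spliced_word m n w (k + i)).
Proof.
move=> m0 k1; elim: i => [|i IHi]; first by rewrite addn0 prefix_refl.
apply: prefix_trans IHi _; rewrite addnS.
have -> : (k + i)%N = (k + i - 2).+2 by lia.
rewrite [X in prefix _ X]spliced_wordS //.
move: (spliced_word m n w (_.+2)) => u; case: m m0 => // m _.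
by rewrite /= -catA prefix_prefix.
Qed.

Lemma card_inflated_le_factors (m n : nat) : (0 < m)%N -> (0 < n)%N ->
  (#|` inflated m n| <= #|factors (limit_words m) (len m n)|)%N.
Proof.
move=> m0 n0; rewrite -card_factor_words; apply: fsubset_leq_card.
apply/fsubsetP => w wA; pose u := spliced_word m n w.
have uA k : (0 < k)%N -> u k \in inflated m k.
  by move=> k0; apply: mem_spliced_word.
have usz k : (0 < k)%N -> size (u k) = len m k.
  by move=> /uA/size_inflated.
(* The word of index i + 3 has at least i + 2 letters, so position i exists; by the prefix property
   every other u_k with k > 1 and more than i letters agrees there. *)
pose x i := nth false (u i.+3) i.
have xE k : (1 < k)%N -> mkseq x (len m k) = u k.
  move=> k1; have k0 := ltnW k1.
  apply: (@eq_from_nth _ false); rewrite size_mkseq ?usz // => i ltik.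
  rewrite nth_mkseq // /x.
  have lti3 : (i < len m i.+3)%N by have := leq_len i.+2 m0; lia.
  have prefix_nth a b : (1 < a)%N -> (a <= b)%N -> (i < len m a)%N ->
      nth false (u b) i = nth false (u a) i.
    move=> a1 ab ltia; have := @prefix_spliced_word m n a (b - a) w m0 a1.
    rewrite subnKC // => /prefixP[s]; rewrite -/(u a) -/(u b) => ->.
    by rewrite nth_cat usz ?ltia //; lia.
  by have [le3|/ltnW lt3] := leqP i.+3 k; [rewrite [RHS](@prefix_nth i.+3)|exact: prefix_nth].
apply/imfsetP; exists (Tuple (introT eqP (size_inflated wA))) => //=.
apply/mem_factors; exists x.
  move=> k k3; apply/imfsetP; exists (u k); first by apply: uA; lia.
  rewrite /subword drop0 -xE; last lia.
  by rewrite /mkseq -map_take take_iota (minn_idPl (leq_pred _)).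
(* The position of w in u_(n+2), just after the m copies of u_(n+1). *)
exists (m * len m n.+1)%N => /=.
have uE : u n.+2 = flatten (nseq m (u n.+1)) ++ w.
  by rewrite /u spliced_wordS // eqxx.
have flsz : size (flatten (nseq m (u n.+1))) = (m * len m n.+1)%N.
  by rewrite size_flatten /shape map_nseq sumn_nseq usz // mulnC.
rewrite -[LHS](drop_size_cat w flsz) -uE -xE //.
rewrite /mkseq -map_drop drop_iota lenS // addKn add0n.
by rewrite -[X in iota X]addn0 iotaDl -map_comp.
Qed.

(** * Existence of the entropy and an upper bound for it *)

Lemma cvgn_inv (R : realType) : (fun n => n%:R^-1 : R) @ \oo --> (0 : R).
Proof. by rewrite -cvg_shiftS; exact: cvg_harmonic. Qed.

(** Fekete's lemma: the limit is the infimum of the quotients. Choose M nearly attaining it and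
    divide N by M with remainder. *)
Lemma subadditive_cvg (R : realType) (a : R^nat) :
  (forall n, 0 <= a n) -> (forall M N, a (M + N)%N <= a M + a N) ->
  cvgn (fun n => a n / n%:R).
Proof.
(* The index starts at 1, since division by zero would put the value 0 into the set. *)
move=> a0 aD; pose E := [set a n.+1 / n.+1%:R | n in [set: nat]].
have E_lb : lbound E 0 by move=> _ [n _ <-]; rewrite divr_ge0.
have E_inf : has_inf E by split; [exists (a 1%N / 1%:R), 0%N | exists 0].
have aMD M q r : a (q * M + r)%N <= q%:R * a M + a r.
  elim: q => [|q IHq]; first by rewrite mul0r add0r.
  rewrite mulSn -addnA (le_trans (aD _ _)) //.
  by rewrite -natr1 mulrDl mul1r [_ * _ + a M]addrC -addrA lerD2l.
apply/cvg_ex; exists (inf E); apply/cvgrPdist_le => e e0.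
have [_ [n _ <-] aM] := inf_adherent (divr_gt0 e0 (ltr0n _ 2)) E_inf.
(* As all terms are nonnegative, B bounds every a r with r < M at once, independently of N. *)
set M := n.+1 in aM; set B := \sum_(r < M) a r.
near=> N.
have N0 : (0 < N)%N by near: N; exact: nbhs_infty_gt.
have NR0 : (0 : R) < N%:R by rewrite ltr0n.
have infN : inf E <= a N / N%:R.
  by apply: ge_inf; [case: E_inf | exists N.-1 => //; rewrite prednK].
rewrite distrC ger0_norm ?subr_ge0 // lerBlDl.
have BN : B / N%:R <= e / 2.
  rewrite ler_pdivrMr // mulrC -ler_pdivrMr ?divr_gt0 //.
  by near: N; exact: nbhs_infty_ger.
have aN : a N <= (N %/ M)%:R * a M + B.
  rewrite [X in a X](divn_eq N M) (le_trans (aMD _ _ _)) // lerD2l /B.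
  have ltr : (N %% M < M)%N by rewrite ltn_mod.
  by rewrite (bigD1 (Ordinal ltr)) //= lerDl sumr_ge0.
have aN' : a N / N%:R <= a M / M%:R + B / N%:R.
  rewrite ler_pdivrMr // mulrDl divfK ?gt_eqF // (le_trans aN) // lerD2r.
  rewrite mulrAC -mulrA mulrC ler_wpM2l // ler_pdivlMr ?ltr0n //.
  by rewrite -natrM ler_nat leq_trunc_div.
by rewrite (le_trans aN') // [e]splitr addrA lerD // ltW.
Unshelve. all: by end_near.
Qed.

(** At k = 0 this rests on the default value 0 of [ln], which also covers empty sets of factors. *)
Lemma ln_natr_ge0 (R : realType) (k : nat) : 0 <= ln (k%:R : R).
Proof. by case: k => [|k]; [rewrite ln0 | rewrite ln_ge0 // ler1n]. Qed.

Lemma entropy_cvg (R : realType) (m : nat) : cvgn (entropy_seq R m).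
Proof.
apply: (@subadditive_cvg R (fun N => ln #|factors (limit_words m) N|%:R)).
  by move=> n; apply: ln_natr_ge0.
move=> M N; set F := factors (limit_words m).
have [->|FMN] := posnP #|F (M + N)%N|; first by rewrite ln0 // addr_ge0 ?ln_natr_ge0.
have := leq_trans FMN (card_factorsD _ M N); rewrite muln_gt0 => /andP[FM FN].
rewrite -lnM ?posrE ?ltr0n // -natrM ler_ln ?posrE ?ltr0n ?muln_gt0 ?FM //.
by rewrite ler_nat card_factorsD.
Qed.

(** The constant K of [card_factors_le] contributes log K / N, which vanishes in the limit. *)
Lemma topological_entropy_le (R : realType) (m n : nat) (c : R) :
  (0 < m)%N -> (0 < n)%N -> 0 <= c ->
  #|` inflated m n|%:R <= expR (c * (len m n)%:R) / 2 ->
  #|` inflated m n.+1|%:R <= expR (c * (len m n.+1)%:R) / 2 ->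
  topological_entropy R m <= c.
Proof.
move=> m0 n0 c0 An An1; have [K FK] := card_factors_le m0 n0 c0 An An1.
(* The maximum with 1 makes the logarithm of the constant defined and nonnegative, as the case of no
   factors requires. *)
pose K' := Num.max K 1.
have K'1 : 1 <= K' by rewrite /K' le_max lexx orbT.
have K'0 : 0 < K' := lt_le_trans ltr01 K'1.
have lnF N : ln #|factors (limit_words m) N|%:R <= ln K' + c * N%:R.
  have [->|F0] := posnP #|factors (limit_words m) N|.
    by rewrite ln0 // addr_ge0 ?ln_ge0 ?mulr_ge0.
  rewrite -[c * _]expRK -lnM ?posrE ?expR_gt0 //.
  rewrite ler_ln ?posrE ?ltr0n ?mulr_gt0 ?expR_gt0 //.
  by rewrite (le_trans (FK N)) // ler_wpM2r ?expR_ge0 // /K' le_max lexx.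
have bound_cvg : (fun N => ln K' * N%:R^-1 + c) @ \oo --> c.
  rewrite -[X in _ --> X]add0r -(mulr0 (ln K')).
  by apply: cvgD; [apply: cvgMr; apply: cvgn_inv | apply: cvg_cst].
apply: (ler_cvg_to (@entropy_cvg R m) bound_cvg); near=> N.
have N0 : (0 : R) < N%:R by rewrite ltr0n; near: N; exact: nbhs_infty_gt.
by rewrite /entropy_seq ler_pdivrMr // mulrDl divfK ?gt_eqF.
Unshelve. all: by end_near.
Qed.

(** * Slow variation of the rates log |A_n| / l_n, and the squeeze *)

Lemma ln_card_inflated_ge (R : realType) (m n : nat) : (0 < n)%N ->
  m%:R * ln #|` inflated m n.+1|%:R + ln #|` inflated m n|%:R
    <= ln #|` inflated m n.+2|%:R :> R.
Proof.
move=> n0; rewrite mulr_natl -lnXn ?ltr0n ?card_inflated_gt0 //.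
rewrite -lnM ?posrE ?exprn_gt0 ?ltr0n ?card_inflated_gt0 //.
rewrite -natrX -natrM ler_ln ?posrE ?ltr0n ?card_inflated_gt0 //.
  by rewrite ler_nat card_inflated_ge.
by rewrite muln_gt0 expn_gt0 !card_inflated_gt0.
Qed.

Lemma ln_card_inflated_le (R : realType) (m n : nat) : (0 < n)%N ->
  ln #|` inflated m n.+2|%:R <= ln m.+1%:R +
    (m%:R * ln #|` inflated m n.+1|%:R + ln #|` inflated m n|%:R) :> R.
Proof.
move=> n0; rewrite mulr_natl -lnXn ?ltr0n ?card_inflated_gt0 //.
rewrite -!lnM ?posrE ?mulr_gt0 ?exprn_gt0 ?ltr0n ?card_inflated_gt0 //.
rewrite -natrX -!natrM ler_ln ?posrE ?ltr0n ?card_inflated_gt0 //.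
  by rewrite ler_nat card_inflated_le.
by rewrite !muln_gt0 expn_gt0 !card_inflated_gt0.
Qed.

(* The determinant W_n = L_(n+1) l_n - L_n l_(n+1), with L_n = log |A_n|,
   satisfies W_(n+1) = - W_n + D l_(n+1) for some 0 <= D <= log (m + 1). *)
Lemma ln_card_inflated_det (R : realType) (m n : nat) :
  (0 < m)%N -> (0 < n)%N ->
  `|ln #|` inflated m n.+1|%:R * (len m n)%:R
    - ln #|` inflated m n|%:R * (len m n.+1)%:R|
  <= ln m.+1%:R * (len m n.+2)%:R :> R.
Proof.
move=> m0; elim: n => // n IHn _; have [->|n0] := posnP n.
  by rewrite /= !cardfs1 ln1 !mul0r subr0 normr0 mulr_ge0 ?ln_natr_ge0.
have W := IHn n0; have low := ln_card_inflated_ge R m n0.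
have up := ln_card_inflated_le R m n0.
have lenD : ((len m n.+2)%:R : R) = m%:R * (len m n.+1)%:R + (len m n)%:R.
  by rewrite lenS // natrD natrM.
(* This lets the bound propagate: the old error is a multiple of l_(n+2), the new term D l_(n+1) is
   at most the same multiple of l_(n+1), and the two lengths add up to at most l_(n+3). *)
have len_le : ((len m n.+2)%:R + (len m n.+1)%:R : R) <= (len m n.+3)%:R.
  by rewrite -natrD ler_nat (lenS m (ltn0Sn n)) leq_add2r leq_pmull.
apply: le_trans (ler_wpM2l (ln_natr_ge0 R m.+1) len_le).
set D := ln #|` inflated m n.+2|%:R -
  (m%:R * ln #|` inflated m n.+1|%:R + ln #|` inflated m n|%:R) : R.
have D0 : 0 <= D by rewrite subr_ge0.
have DC : D <= ln m.+1%:R by rewrite lerBlDr.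
rewrite [X in `|X|](_ : _ = D * (len m n.+1)%:R -
    (ln #|` inflated m n.+1|%:R * (len m n)%:R
    - ln #|` inflated m n|%:R * (len m n.+1)%:R)); last first.
  by rewrite lenD /D; ring.
rewrite (le_trans (ler_normB _ _)) // addrC mulrDr lerD //.
by rewrite ger0_norm ?mulr_ge0 // ler_wpM2r.
Qed.

(** The difference is the determinant divided by l_n l_(n+1); the bound l_(n+2) <= (m + 1) l_(n+1)
    cancels one length and leaves a constant over l_n. *)
Lemma ln_card_inflated_ratio (R : realType) (m n : nat) :
  (0 < m)%N -> (0 < n)%N ->
  `|ln #|` inflated m n.+1|%:R / (len m n.+1)%:R
    - ln #|` inflated m n|%:R / (len m n)%:R|
  <= ln m.+1%:R * m.+1%:R / (len m n)%:R :> R.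
Proof.
move=> m0 n0; have W := @ln_card_inflated_det R m n m0 n0.
have l0 : (0 : R) < (len m n)%:R by rewrite ltr0n len_gt0.
have l1 : (0 : R) < (len m n.+1)%:R by rewrite ltr0n len_gt0.
have len_le : ((len m n.+2)%:R : R) <= m.+1%:R * (len m n.+1)%:R.
  by rewrite -natrM ler_nat lenS // mulSn addnC leq_add2r leq_lenS.
rewrite [X in `|X|](_ : _ = (ln #|` inflated m n.+1|%:R * (len m n)%:R
    - ln #|` inflated m n|%:R * (len m n.+1)%:R) /
    ((len m n)%:R * (len m n.+1)%:R)); last by field; rewrite !gt_eqF.
rewrite normrM [X in _ * X]ger0_norm; last by rewrite invr_ge0 mulr_ge0 ?ltW.
rewrite ler_pdivrMr ?mulr_gt0 // mulrA divfK ?gt_eqF // -mulrA.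
by rewrite (le_trans W) // ler_wpM2l ?ln_natr_ge0.
Qed.

(** Apply [topological_entropy_le] with c = h_n + e: in e, the term log 2 / l_n pays for the factors
    1/2, and the other term for passing from h_n to h_(n+1). *)
Lemma topological_entropy_le_inflated (R : realType) (m n : nat) :
  (0 < m)%N -> (0 < n)%N ->
  topological_entropy R m - (ln 2 + ln m.+1%:R * m.+1%:R) * (len m n)%:R^-1
    <= ln #|` inflated m n|%:R / (len m n)%:R.
Proof.
move=> m0 n0.
have l0 : (0 : R) < (len m n)%:R by rewrite ltr0n len_gt0.
have l1 : (0 : R) < (len m n.+1)%:R by rewrite ltr0n len_gt0.
rewrite lerBlDr; set h := ln _ / _.
have ln2 : 0 <= ln 2 :> R by apply: (ln_natr_ge0 R 2).
have ratio := @ln_card_inflated_ratio R m n m0 n0.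
set e := (ln 2 + _) * _.
have eE : e = ln 2 / (len m n)%:R + ln m.+1%:R * m.+1%:R / (len m n)%:R.
  by rewrite /e mulrDl.
have h0 : 0 <= h by rewrite divr_ge0 ?ln_natr_ge0.
have e0 : 0 <= e by rewrite divr_ge0 ?addr_ge0 ?mulr_ge0 ?ln_natr_ge0.
have bound k : (0 < k)%N -> (len m n <= len m k)%N ->
    ln #|` inflated m k|%:R / (len m k)%:R <=
      h + ln m.+1%:R * m.+1%:R / (len m n)%:R ->
    #|` inflated m k|%:R <= expR ((h + e) * (len m k)%:R) / 2.
  move=> k0 lek hk.
  have lk : (0 : R) < (len m k)%:R by rewrite ltr0n len_gt0.
  have Ak : (0 : R) < #|` inflated m k|%:R by rewrite ltr0n card_inflated_gt0.
  rewrite ler_pdivlMr // -[X in X <= _](@lnK R) ?posrE ?mulr_gt0 //.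
  rewrite ler_expR lnM ?posrE //.
  have -> : ln #|` inflated m k|%:R =
      ln #|` inflated m k|%:R / (len m k)%:R * (len m k)%:R :> R.
    by rewrite divfK ?gt_eqF.
  (* Here l_n <= l_k is used, for k = n and k = n + 1. *)
  have ln2k : ln 2 <= ln 2 / (len m n)%:R * (len m k)%:R :> R.
    by rewrite mulrAC ler_pdivlMr // ler_wpM2l // ler_nat.
  rewrite eE [h + _]addrCA [X in _ <= X]mulrDl [X in X <= _]addrC lerD //.
  by rewrite ler_wpM2r // ltW.
apply: (@topological_entropy_le R m n) => //; first exact: addr_ge0.
  by apply: bound => //; rewrite lerDl divr_ge0 ?mulr_ge0 ?ln_natr_ge0.
apply: bound => //; first exact: leq_lenS.
by rewrite -lerBlDl (le_trans (ler_norm _)).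
Qed.

Theorem theorem3 (R : realType) (m : nat) (hm : (1 <= m)%N) :
  [/\ cvgn (entropy_seq R m),
      (fun n : nat => ln (#|` inflated m n|%:R) / (len m n)%:R : R) @ \oo
        --> topological_entropy R m
    & (fun n : nat => ln (#|factors (limit_words m) (len m n)|%:R)
        / (len m n)%:R : R) @ \oo
        --> topological_entropy R m].
Proof.
have len_cvg : len m n @[n --> \oo] --> \oo.
  apply/cvgnyPge => A; near=> n.
  have An : (A < n)%N by near: n; exact: nbhs_infty_gt.
  by have := leq_len n.-1 hm; rewrite prednK; lia.
(* A subsequence of the convergent [entropy_seq], taken along the lengths l_n. *)
have factors_cvg : (fun n : nat =>
    ln (#|factors (limit_words m) (len m n)|%:R) / (len m n)%:R : R) @ \oo
      --> topological_entropy R m.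
  exact: (cvg_comp _ _ len_cvg (@entropy_cvg R m)).
split=> //; first exact: entropy_cvg.
apply: (squeeze_cvgr _ _ factors_cvg); last first.
  rewrite -[X in _ --> X]subr0 -(mulr0 (ln 2 + ln m.+1%:R * m.+1%:R)).
  apply: cvgB; first exact: cvg_cst.
  apply: cvgMr; exact: (cvg_comp _ _ len_cvg (@cvgn_inv R)).
near=> n; have n0 : (0 < n)%N by near: n; exact: nbhs_infty_gt.
rewrite topological_entropy_le_inflated //= ler_wpM2r ?invr_ge0 //.
rewrite ler_ln ?posrE ?ltr0n ?card_inflated_gt0 //.
  by rewrite ler_nat card_inflated_le_factors.
(* F_n is nonempty because it has at least as many elements as A_n. *)
by rewrite (leq_trans _ (card_inflated_le_factors hm n0)) ?card_inflated_gt0.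
Unshelve. all: by end_near.
Qed.
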